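(* Let $k,n$ be positive integers and let $\mathcal{S}=\{S_1,\dots,S_k\}$ be a set system where $S_i\subseteq [n]$ for all $i\in [k]$. Suppose $\mathcal{S}$ satisfies the MDS condition and, for all $i\in [k]$, we have $\left|\bigcap_{j=1}^{i} S_j\right|=k-i$. Then for any finite field $\mathbb{F}_q$ with $q \geqslant n$, there exists a $k\times n$ MDS matrix $A$ over $\mathbb{F}_q$ such that, for all $i\in[k]$ and $j\in[n]$, $A_{i,j}=0$ if and only if $j\in S_i$.
   Context: For a positive integer $n$, $[n]:=\{1,\dots,n\}$. $\mathbb{F}_q$ denotes the finite field with $q$ elements, $q$ a prime power. A set system $\mathcal{S}=\{S_1,\dots,S_k\}$ is an indexed family of subsets $S_i\subseteq[n]$. It satisfies the MDS condition if, for any nonempty $I\subseteq [k]$, $|I|+\left| \bigcap_{i\in I} S_i \right| \leqslant k$. A $k\times n$ matrix over $\mathbb{F}_q$ is called MDS if every $k\times k$ submatrix of it is invertible. *)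

(* Defs.v *)
From mathcomp Require Import all_boot all_algebra.

Set Implicit Arguments.
Unset Strict Implicit.
Unset Printing Implicit Defensive.

Local Open Scope ring_scope.

Definition MDS_condition (k n : nat) (S : 'I_k -> {set 'I_n}) : Prop :=
  forall I : {set 'I_k}, I != set0 ->
    (#|I| + #|\bigcap_(i in I) S i| <= k)%N.

(* A k x k submatrix is given by its k columns, listed in increasing order;
   if n < k there are none. *)
Definition MDS_matrix (F : fieldType) (k n : nat) (A : 'M[F]_(k, n)) : Prop :=
  forall c : 'I_k -> 'I_n, {homo c : i j / (i < j)%N} ->
    colsub c A \in unitmx.

(* Main.v *)
Require Import Defs.
From mathcomp Require Import all_boot all_algebra.

(** Row [i] of the matrix lists the values, at [n] distinct points of [F], of the
    polynomial [f_i] of degree [#|S i| < k] whose simple roots are the points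
    indexed by [S i]. A nonzero polynomial of degree less than [k] has fewer than
    [k] roots, so every k x k submatrix is invertible as soon as the [f_i] are
    linearly independent. For [i > 0] the cardinality hypothesis gives a point in
    [S 0, ..., S (i - 1)] but not in [S i], at which [f_0, ..., f_(i - 1)] vanish
    and [f_i] does not: the system is triangular. *)

Import GRing.Theory.
Local Open Scope ring_scope.

Lemma size_linear_comb (F : fieldType) (k m : nat) (f : 'I_k -> {poly F})
    (u : 'I_k -> F) :
  (forall i, (size (f i) <= m)%N) -> (size (\sum_i u i *: f i)%R <= m)%N.
Proof.
move=> size_f; elim/big_ind: _ => [|p q sp sq|i _]; first by rewrite size_poly0.
  by apply: leq_trans (size_polyD _ _) _; rewrite geq_max sp.
exact: leq_trans (size_scale_leq _ _) (size_f i).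
Qed.

(** Descending induction on [i]: once the later coefficients vanish, evaluating at the point [x]
    given for [i] kills the earlier terms and leaves [u i * (f i).[x] = 0]. *)
Lemma triangular_poly_independent (F : fieldType) (k : nat)
    (f : 'I_k -> {poly F}) (u : 'I_k -> F) :
    (forall i, f i != 0) ->
    (forall i : 'I_k, (0 < i)%N -> exists2 x : F,
       forall j : 'I_k, (j < i)%N -> (f j).[x] = 0 & (f i).[x] != 0) ->
    \sum_i u i *: f i = 0 ->
  forall i, u i = 0.
Proof.
move=> f_neq0 sep sum0 i.
have [m] := ubnP (k - i); elim: m i => // m IHm i lt_ki_m.
have u_gt0 (j : 'I_k) : (i < j)%N -> u j = 0.
  move=> lt_ij; apply: IHm; apply: leq_trans (ltn_sub2l _ lt_ij) _ => //.
have [i_gt0|i_le0] := ltnP 0 i.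
  have [x fx0 fix_neq0] := sep i i_gt0.
  have := congr1 (horner^~ x) sum0; rewrite horner_sum (bigD1 i) //= big1.
    rewrite addr0 hornerZ horner0 => /eqP; rewrite mulf_eq0 (negPf fix_neq0).
    by rewrite orbF => /eqP.
  move=> j; rewrite -val_eqE neq_ltn hornerZ => /orP[/fx0-> | /u_gt0->].
    by rewrite mulr0.
  by rewrite mul0r.
(* Here [i] is 0: there is no earlier term, so the sum is [u i *: f i] itself. *)
move: sum0; rewrite (bigD1 i) //= big1 => [|j].
  by rewrite addr0 => /eqP; rewrite scaler_eq0 (negPf (f_neq0 i)) orbF => /eqP.
rewrite -val_eqE neq_ltn => /orP[lt_ji | /u_gt0->]; last by rewrite scale0r.
by have := leq_trans lt_ji i_le0.
Qed.

Lemma evaluation_matrix_MDS (F : fieldType) (k n : nat)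
    (f : 'I_k -> {poly F}) (a : 'I_n -> F) :
    injective a -> (forall i, (size (f i) <= k)%N) ->
    (forall u : 'I_k -> F, \sum_i u i *: f i = 0 -> forall i, u i = 0) ->
  MDS_matrix (\matrix_(i, j) (f i).[a j]).
Proof.
move=> a_inj size_f f_free c c_mono.
have c_inj : injective c.
  move=> i j eq_c; apply: val_inj; case: (ltngtP i j) => // /c_mono;
    by rewrite eq_c ltnn.
(* A vector [v] in the left kernel gives a combination of the [f i] vanishing at the [k] distinct
   points [a (c j)]. *)
rewrite -row_free_unit; apply: inj_row_free => v v0.
apply/rowP=> i; rewrite mxE; apply: (f_free (v 0)) i.
apply: (@roots_geq_poly_eq0 _ _ [seq a (c j) | j <- enum 'I_k]).
- apply/allP=> _ /mapP[j _ ->]; apply/rootP.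
  have /rowP/(_ j) := v0; rewrite !mxE => v0j; rewrite -[RHS]v0j horner_sum.
  by apply: eq_bigr => l _; rewrite hornerZ !mxE.
- by rewrite (map_inj_uniq (f := a \o c)) ?enum_uniq //; apply: inj_comp.
- by rewrite size_map size_enum_ord; apply: size_linear_comb.
Qed.

Lemma root_prod_XsubC_set (F : fieldType) (I : finType) (a : I -> F)
    (S : {set I}) (i : I) :
  injective a -> root (\prod_(s in S) ('X - (a s)%:P)) (a i) = (i \in S).
Proof.
move=> a_inj; rewrite /root horner_prod; apply/prodf_eq0/idP => [[s sS]|iS].
  by rewrite hornerXsubC subr_eq0 => /eqP/a_inj->.
by exists i; rewrite // hornerXsubC subrr.
Qed.

(** The first [i] sets share [k - i] points, one more than the first [i.+1] sets do, so some point
    is lost when [S i] joins. *)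
Lemma prefix_separation (k n : nat) (S : 'I_k -> {set 'I_n})
    (S_prefix : forall i : 'I_k,
       #|\bigcap_(j < k | (j <= i)%N) S j| = (k - i.+1)%N) (i : 'I_k) :
  (0 < i)%N ->
  exists2 t, forall j : 'I_k, (j < i)%N -> t \in S j & t \notin S i.
Proof.
move=> i_gt0; have i1_lt : (i.-1 < k)%N by rewrite (leq_ltn_trans (leq_pred i)).
have /subsetPn[t /bigcapP t_in t_notin] :
    ~~ (\bigcap_(j < k | (j <= Ordinal i1_lt)%N) S j
          \subset \bigcap_(j < k | (j <= i)%N) S j).
  apply/negP=> /subset_leq_card; rewrite !S_prefix /= prednK //.
  by rewrite leqNgt ltn_sub2l.
have t_lt (j : 'I_k) : (j < i)%N -> t \in S j.
  by move=> lt_ji; apply: t_in; rewrite /= -ltnS prednK.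
exists t => //; apply: contra t_notin => t_i; apply/bigcapP=> j.
by rewrite leq_eqVlt => /orP[/eqP/val_inj-> | /t_lt].
Qed.

(* With 0-based indices, the informal |S_1 \cap ... \cap S_i| = k - i becomes
   a condition on the first i.+1 sets. *)
Theorem theorem2p5 (k n : nat) (k_gt0 : (0 < k)%N) (n_gt0 : (0 < n)%N)
    (S : 'I_k -> {set 'I_n}) (S_MDS : MDS_condition S)
    (S_prefix : forall i : 'I_k,
       #|\bigcap_(j < k | (j <= i)%N) S j| = (k - i.+1)%N)
    (F : finFieldType) (q_ge_n : (n <= #|F|)%N) :
  exists A : 'M[F]_(k, n),
    MDS_matrix A /\
    forall (i : 'I_k) (j : 'I_n), A i j = 0 <-> j \in S i.
Proof.
pose a (j : 'I_n) : F := enum_val (widen_ord q_ge_n j).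
have a_inj : injective a.
  by move=> i j /enum_val_inj/(congr1 val)/= /val_inj.
pose f i : {poly F} := \prod_(s in S i) ('X - (a s)%:P).
have root_f i j : root (f i) (a j) = (j \in S i) by apply: root_prod_XsubC_set.
have size_f i : size (f i) = #|S i|.+1.
  by rewrite /f -big_enum size_prod_XsubC -cardE.
exists (\matrix_(i, j) (f i).[a j]); split; last first.
  by move=> i j; rewrite mxE -root_f; split=> /rootP.
apply: evaluation_matrix_MDS => // [i | u].
  (* On a singleton the MDS condition reads [1 + #|S i| <= k], the required size bound. *)
  have := S_MDS [set i]; rewrite big_set1 cards1 size_f; apply.
  by rewrite -cards_eq0 cards1.
apply: triangular_poly_independent => [i | i i_gt0].
  by rewrite -size_poly_eq0 size_f.
have [t t_lt t_i] := prefix_separation _ _ _ S_prefix i i_gt0.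
exists (a t) => [j /t_lt t_j|]; first by apply/rootP; rewrite root_f.
by rewrite -[_ == 0]/(root (f i) (a t)) root_f.
Qed.
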